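(* The map $$F:\mathbb{C}\to\mathbb{C}^2=\mathbb{R}^4,\qquad z=u+iv\mapsto\Big(\frac{z^5}{5}-z+\bar{z},\ -\frac{z^3}{3}+\frac{\bar{z}^3}{3}+z+\bar{z}\Big),$$ that is, in real coordinates, $$F(u+iv)=\Big(\tfrac{u^5}{5}-2u^3v^2+uv^4,\ \ \tfrac{v^5}{5}+u^4v-2u^2v^3-2v,\ \ 2u,\ \ \tfrac{2v^3}{3}-2u^2v\Big),$$ is a minimal embedding of $\mathbb{C}$ in $\mathbb{R}^4$ of total curvature $-8\pi$. It is preserved by the symmetries with respect to the planes generated by $(e_1,e_3)$ and $(e_2,e_4)$.
   Context: $(e_1,e_2,e_3,e_4)$ is the standard orthonormal basis of $\mathbb{R}^4$, and $(x_1,x_2,x_3,x_4)\in\mathbb{R}^4$ is identified with $(x_1+ix_2,x_3+ix_4)\in\mathbb{C}^2$. A map from a Riemann surface to $\mathbb{R}^4$ is minimal if it is conformal and harmonic. Total curvature means $\int K^T dA$, where $K^T$ is the Gauss curvature of the induced metric. The symmetry with respect to a plane $P$ is the orthogonal reflection that is the identity on $P$ and $-1$ on $P^\perp$; ''preserved'' means that the surface $F(\mathbb{C})$ is mapped to itself. *)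

(* Defs.v *)
From HB Require Import structures.
From mathcomp Require Import all_boot all_order all_algebra.
From mathcomp Require Import all_classical all_reals all_analysis.
From mathcomp Require Import complex.

Set Implicit Arguments.
Unset Strict Implicit.
Unset Printing Implicit Defensive.

Import Order.TTheory GRing.Theory Num.Theory.
Import numFieldNormedType.Exports.
Local Open Scope classical_set_scope.
Local Open Scope ring_scope.

(* The domain C is carried by R * R, through (u, v) |-> u + iv: this is the
   type on which the library provides both the real differential calculus and
   the product Lebesgue measure.  'rV[R]_4 is R^4 with its usual topology; its
   library norm is the sup norm, so the Euclidean inner product is explicit. *)

Section Calculus.
Variables (R : realType) (V W : normedModType R).

Fixpoint is_Ck (k : nat) (f : V -> W) : Prop :=
  match k with
  | 0 => continuous f
  | k'.+1 => (forall p, differentiable f p) /\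
             (forall v, is_Ck k' (fun p => 'D_v f p))
  end.

Definition smooth (f : V -> W) : Prop := forall k, is_Ck k f.

Definition is_immersion (f : V -> W) : Prop :=
  smooth f /\ forall p, injective ('d f p : V -> W).

(* The last clause says that f is open onto its image; with continuity and
   injectivity, f is a homeomorphism onto its image. *)
Definition is_embedding (f : V -> W) : Prop :=
  [/\ is_immersion f,
      injective f &
      forall U : set V, open U ->
        exists2 O : set W, open O & f @` U = range f `&` O].

End Calculus.

Section Plane.
Variable R : realType.

Definition dir (i : 'I_2) : R * R := if i == 0 then (1, 0) else (0, 1).

Definition partial (W : normedModType R) (i : 'I_2) (f : R * R -> W)
  : R * R -> W := fun p => 'D_(dir i) f p.

Definition inner_plane (v w : R * R) : R := v.1 * w.1 + v.2 * w.2.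

Definition inner n (x y : 'rV[R]_n) : R := \sum_(k < n) x 0 k * y 0 k.

Definition conformal n (f : R * R -> 'rV[R]_n) : Prop :=
  is_Ck 1 f /\
  forall p, exists2 lam : R, 0 < lam &
    forall v w, inner ('d f p v) ('d f p w) = lam * inner_plane v w.

Definition harmonic n (f : R * R -> 'rV[R]_n) : Prop :=
  is_Ck 2 f /\ forall p, \sum_(i < 2) partial i (partial i f) p = 0.

Definition minimal n (f : R * R -> 'rV[R]_n) : Prop :=
  conformal f /\ harmonic f.

Section Metric.
Variable g : R * R -> 'M[R]_2.

Definition christoffel (k i j : 'I_2) (p : R * R) : R :=
  2^-1 * \sum_(l < 2) invmx (g p) k l *
    (partial i (fun q => g q j l) p + partial j (fun q => g q i l) p
     - partial l (fun q => g q i j) p).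

(* R(d_i, d_j) d_k = \sum_l (riemann l k i j) d_l, with
   R(X, Y) Z = D_X D_Y Z - D_Y D_X Z - D_[X, Y] Z *)
Definition riemann (l k i j : 'I_2) (p : R * R) : R :=
  partial i (christoffel l j k) p - partial j (christoffel l i k) p
  + \sum_(m < 2) (christoffel l i m p * christoffel m j k p
                  - christoffel l j m p * christoffel m i k p).

(* g(R(d_0, d_1) d_1, d_0) / det g: positive on round spheres *)
Definition gauss_curvature (p : R * R) : R :=
  (\sum_(l < 2) riemann l 1 0 1 p * g p l 0) / \det (g p).

Definition area_density (p : R * R) : R := Num.sqrt (\det (g p)).

End Metric.

Definition induced_metric n (f : R * R -> 'rV[R]_n) (p : R * R) : 'M[R]_2 :=
  \matrix_(i, j) inner (partial i f p) (partial j f p).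

Definition curvature_density n (f : R * R -> 'rV[R]_n)
    (p : measurableTypeR R * measurableTypeR R) : \bar R :=
  (gauss_curvature (induced_metric f) p
   * area_density (induced_metric f) p)%:E.

Definition has_total_curvature n (f : R * R -> 'rV[R]_n) (c : R) : Prop :=
  let mu := (@lebesgue_measure R \x @lebesgue_measure R)%E in
  mu.-integrable setT (curvature_density f) /\
  (\int[mu]_p curvature_density f p)%E = c%:E.

End Plane.

Section Symmetry.
Variable R : realType.

(* Subspaces of R^n are row spaces of square matrices, as in mxalgebra;
   the rows of kermx P^T span the vectors orthogonal to all the rows of P. *)
Definition orthogonal_complement n (P : 'M[R]_n) : 'M[R]_n := kermx P^T.

(* proj_mx A B projects onto A along B *)
Definition symmetry n (P : 'M[R]_n) (x : 'rV[R]_n) : 'rV[R]_n :=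
  let Q := orthogonal_complement P in
  x *m proj_mx P Q - x *m proj_mx Q P.

Definition preserved_by n (s : 'rV[R]_n -> 'rV[R]_n) (S : set 'rV[R]_n) : Prop :=
  s @` S = S.

(* e_1, ..., e_4 are basis_vector 0, ..., basis_vector 3 *)
Definition basis_vector (k : 'I_4) : 'rV[R]_4 := delta_mx 0 k.

Definition plane (j k : 'I_4) : 'M[R]_4 :=
  (basis_vector j + basis_vector k)%MS.

End Symmetry.

Section Surface.
Variable R : realType.

Definition vec4 (a b c d : R) : 'rV[R]_4 := \row_k [:: a; b; c; d]`_k.

Definition R4_of_C2 (w : R[i] * R[i]) : 'rV[R]_4 :=
  vec4 (complex.Re w.1) (complex.Im w.1) (complex.Re w.2) (complex.Im w.2).

Definition surfaceC (z : R[i]) : R[i] * R[i] :=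
  (z ^+ 5 / 5 - z + z^*%C, - (z ^+ 3 / 3) + z^*%C ^+ 3 / 3 + z + z^*%C).

Definition surface (p : R * R) : 'rV[R]_4 :=
  R4_of_C2 (surfaceC (Complex p.1 p.2)).

End Surface.

(* Main.v *)
Require Import Defs.
From HB Require Import structures.
From mathcomp Require Import all_boot all_order all_algebra.
From mathcomp Require Import all_classical all_reals all_analysis.
From mathcomp Require Import complex.
From mathcomp Require Import measurable_realfun ring lra.

Set Implicit Arguments.
Unset Strict Implicit.
Unset Printing Implicit Defensive.

Import Order.TTheory GRing.Theory Num.Theory.
Import numFieldNormedType.Exports.
Local Open Scope classical_set_scope.
Local Open Scope ring_scope.

(** Write both complex coordinates as h + conj k with h, k holomorphic:
    h1 = z^5/5 - z, k1 = z, h2 = z - z^3/3, k2 = z + z^3/3.  Harmonicity is then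
    automatic, and conformality is h1' k1' + h2' k2' = (z^4 - 1) + (1 - z^4) = 0.
    The induced metric is lambda (du^2 + dv^2) with
      lambda = |h1'|^2 + |k1'|^2 + |h2'|^2 + |k2'|^2
             = (1 + |z^2 - 1|^2) (1 + |z^2 + 1|^2),
    which never vanishes, so the map is an immersion ([surface_isometric]).

    It is injective because the third coordinate gives u, and for a given u the
    other three coordinates separate the values of v.  The third and fourth
    coordinates alone make the map proper, and a proper continuous map is closed
    ([proper_closed_map]), so the surface is embedded.  The two symmetries are
    those of the parametrization under (u, v) -> (u, -v) and (u, v) -> (-u, v).

    For a conformal metric the curvature form is
      K dA = - (1/2) Laplacian (log lambda) du dv
    ([conformal_curvature_density]).  By the divergence theorem on the square
    [-a, a]^2, its integral there is minus one half of the flux of the gradient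
    of log lambda through the four sides.  These four fluxes are equal, since
    lambda is invariant under the symmetries of the square.  As
    lambda is asymptotic to r^8, its logarithmic gradient is close to that of
    8 log r, whose flux through the side u = a is
      \int_(-a)^a 8 a / (a^2 + v^2) dv = 8 (atan 1 - atan (-1)) = 4 pi.
    The error is O(1/a) ([flux_bounds]), so the integral over the square tends
    to - (1/2) * 4 * 4 pi = - 8 pi.  As K <= 0 everywhere, monotone convergence
    carries this limit over to the integral on the plane.

    All the functions that get differentiated are rational in (u, v) without
    real poles.  They are handled by reflection: [ratderiv] differentiates their
    expressions, so that every concrete derivative is obtained by computation
    and the identities above become polynomial identities. *)

(** * Rational functions of (u, v) without poles *)

Section RationalFunctions.
Variable R : realType.

Inductive ratexp : Type :=
| Cst of R | VarU | VarV
| Add of ratexp & ratexp | Mul of ratexp & ratexp | Inv of ratexp.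

Fixpoint rateval (e : ratexp) (p : R * R) : R :=
  match e with
  | Cst c => c
  | VarU => p.1
  | VarV => p.2
  | Add a b => rateval a p + rateval b p
  | Mul a b => rateval a p * rateval b p
  | Inv a => (rateval a p)^-1
  end.

Fixpoint polefree (e : ratexp) : Prop :=
  match e with
  | Add a b | Mul a b => polefree a /\ polefree b
  | Inv a => polefree a /\ forall p, rateval a p != 0
  | _ => True
  end.

Fixpoint ratderiv (w : R * R) (e : ratexp) : ratexp :=
  match e with
  | Cst _ => Cst 0
  | VarU => Cst w.1
  | VarV => Cst w.2
  | Add a b => Add (ratderiv w a) (ratderiv w b)
  | Mul a b => Add (Mul (ratderiv w a) b) (Mul a (ratderiv w b))
  | Inv a => Mul (Cst (-1)) (Mul (ratderiv w a) (Mul (Inv a) (Inv a)))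
  end.

Lemma polefree_deriv w e : polefree e -> polefree (ratderiv w e).
Proof. by elim: e => //= [a IHa b IHb|a IHa b IHb|a IHa] []; intuition. Qed.

Lemma rateval_differentiable e : polefree e ->
  forall p, differentiable (rateval e) p.
Proof.
elim: e => [c|||a IHa b IHb|a IHa b IHb|a IHa] /=.
- by move=> _ p; exact: differentiable_cst.
- by move=> _ p; apply: (linear_differentiable (f := fst)) => q; exact: cvg_fst.
- by move=> _ p; apply: (linear_differentiable (f := snd)) => q; exact: cvg_snd.
- by move=> [/IHa da /IHb db] p; exact: differentiableD.
- by move=> [/IHa da /IHb db] p; exact: differentiableM.
- by move=> [/IHa da na] p; exact: differentiableV.
Qed.

Lemma rateval_derive w e : polefree e ->
  forall p, 'D_w (rateval e) p = rateval (ratderiv w e) p.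
Proof.
elim: e => [c|||a IHa b IHb|a IHa b IHb|a IHa] /=.
- by move=> _ p; exact: derive_cst.
- move=> _ p; rewrite deriveE; last exact: (@rateval_differentiable VarU).
  by rewrite (diff_lin (f := fst)) // => q; exact: cvg_fst.
- move=> _ p; rewrite deriveE; last exact: (@rateval_differentiable VarV).
  by rewrite (diff_lin (f := snd)) // => q; exact: cvg_snd.
- move=> [pa pb] p.
  have da := diff_derivable (v := w) (rateval_differentiable pa p).
  have db := diff_derivable (v := w) (rateval_differentiable pb p).
  by rewrite deriveD // IHa // IHb.
- move=> [pa pb] p.
  have da := diff_derivable (v := w) (rateval_differentiable pa p).
  have db := diff_derivable (v := w) (rateval_differentiable pb p).
  rewrite deriveM // IHa // IHb // addrC; congr (_ + _).
  by rewrite /GRing.scale /= mulrC.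
- move=> [pa na] p.
  have da := diff_derivable (v := w) (rateval_differentiable pa p).
  by rewrite deriveV // IHa // /GRing.scale /=; field; exact: na.
Qed.

Lemma rateval_partial e i : polefree e ->
  partial i (rateval e) = rateval (ratderiv (dir R i) e).
Proof. by move=> pe; apply/funext => p; exact: rateval_derive. Qed.

Lemma rateval_continuous e : polefree e -> continuous (rateval e).
Proof.
by move=> pe p; apply: differentiable_continuous; exact: rateval_differentiable.
Qed.

Definition rateval_row n (e : 'I_n -> ratexp) (p : R * R) : 'rV[R]_n :=
  \row_k rateval (e k) p.

Lemma rateval_row_differentiable n (e : 'I_n -> ratexp) :
  (forall k, polefree (e k)) -> forall p, differentiable (rateval_row e) p.
Proof.
move=> pe p.
have -> : rateval_row e = \sum_(k < n) (fun q => rateval (e k) q *: delta_mx 0 k).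
  apply/funext => q; rewrite (row_sum_delta (rateval_row e q)) fct_sumE.
  by apply: eq_bigr => k _; rewrite mxE.
apply: differentiable_sum => k; apply: differentiableZl.
exact: rateval_differentiable.
Qed.

Lemma rateval_row_derive n (e : 'I_n -> ratexp) w :
  (forall k, polefree (e k)) ->
  (fun p => 'D_w (rateval_row e) p) = rateval_row (fun k => ratderiv w (e k)).
Proof.
move=> pe; apply/funext => p.
rewrite derive_mx; last exact/diff_derivable/rateval_row_differentiable.
apply/matrixP => i k; rewrite !mxE -rateval_derive //.
by congr ('D_w _ p); apply/funext => q; rewrite mxE.
Qed.

Lemma rateval_row_partial n (e : 'I_n -> ratexp) i :
  (forall k, polefree (e k)) ->
  partial i (rateval_row e) = rateval_row (fun k => ratderiv (dir R i) (e k)).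
Proof. exact: rateval_row_derive. Qed.

(** The class of such maps is stable under directional derivatives, which is
    all that the recursive definition of C^k asks for. *)
Lemma rateval_row_smooth n (e : 'I_n -> ratexp) :
  (forall k, polefree (e k)) -> smooth (rateval_row e).
Proof.
move=> pe m; elim: m e pe => [|m IHm] e pe /=.
  by move=> p; apply: differentiable_continuous; exact: rateval_row_differentiable.
split=> [|w]; first exact: rateval_row_differentiable.
by rewrite rateval_row_derive //; apply: IHm => k; exact: polefree_deriv.
Qed.

Let mR : measurableType _ := measurableTypeR R.

(** The sigma-algebra of the plane is defined as a product, not from open sets, so
    this follows the structure of the expression instead of using continuity. *)
Lemma rateval_measurable e : polefree e ->
  measurable_fun setT (rateval e : mR * mR -> R).
Proof.
elim: e => [c|||a IHa b IHb|a IHa b IHb|a IHa] /=.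
- by move=> _; exact: measurable_cst.
- by move=> _; exact: measurable_fst.
- by move=> _; exact: measurable_snd.
- by move=> [/IHa ma /IHb mb]; exact: measurable_funD.
- by move=> [/IHa ma /IHb mb]; exact: measurable_funM.
- move=> [/IHa ma na].
  have mV : measurable_fun [set x : R | x != 0] (@GRing.inv R).
    apply: open_continuous_measurable_fun; first exact: open_neq.
    by move=> x /set_mem /= x0; exact: inv_continuous.
  apply: (measurable_comp _ _ mV ma) => //.
    by apply: open_measurable; exact: open_neq.
  by move=> _ [p _ <-] /=; exact: na.
Qed.

End RationalFunctions.

(** * Orthogonal symmetries *)

Section Symmetries.
Variable R : realType.

(** A vector y P of the row space that is orthogonal to the rows of P has
    square norm y P x^T = y (x P^T)^T = 0. *)
Lemma capmx_orthogonal_complement n (P : 'M[R]_n) :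
  (P :&: orthogonal_complement P = 0)%MS.
Proof.
apply/eqP; rewrite -submx0; apply/row_subP => i.
move: (row i _) (row_sub i (P :&: orthogonal_complement P)%MS) => x.
rewrite sub_capmx => /andP[/submxP[y xE] /sub_kermxP xP].
have /matrixP/(_ 0 0) : x *m x^T = 0 by rewrite {2}xE trmx_mul mulmxA xP mul0mx.
rewrite !mxE => /eqP.
have -> : \sum_j x 0 j * x^T j 0 = \sum_j x 0 j ^+ 2.
  by apply: eq_bigr => j _; rewrite mxE expr2.
rewrite psumr_eq0 => [/allP x0|j _]; last exact: sqr_ge0.
suff -> : x = 0 by exact: sub0mx.
apply/rowP => j; rewrite mxE; apply/eqP.
by move: (x0 j (mem_index_enum _)); rewrite implyTb sqrf_eq0.
Qed.

Lemma symmetry_id n (P : 'M[R]_n) (x : 'rV_n) : (x <= P)%MS -> symmetry P x = x.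
Proof.
move=> xP; rewrite /symmetry proj_mx_id ?capmx_orthogonal_complement //.
by rewrite proj_mx_0 ?subr0 // capmxC capmx_orthogonal_complement.
Qed.

Lemma symmetry_opp n (P : 'M[R]_n) (x : 'rV_n) :
  x *m P^T = 0 -> symmetry P x = - x.
Proof.
move=> /sub_kermxP xP; rewrite /symmetry.
rewrite proj_mx_0 ?capmx_orthogonal_complement //.
by rewrite proj_mx_id ?sub0r // capmxC capmx_orthogonal_complement.
Qed.

Lemma symmetryD n (P : 'M[R]_n) (x y : 'rV_n) :
  symmetry P (x + y) = symmetry P x + symmetry P y.
Proof. by rewrite /symmetry !mulmxDl opprD addrACA. Qed.

Lemma symmetry_plane (j k : 'I_4) (x : 'rV[R]_4) :
  symmetry (plane R j k) x =
  \row_i (if (i == j) || (i == k) then x 0 i else - x 0 i).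
Proof.
pose y : 'rV[R]_4 := \row_i (if (i == j) || (i == k) then x 0 i else 0).
pose z : 'rV[R]_4 := \row_i (if (i == j) || (i == k) then 0 else x 0 i).
have -> : x = y + z.
  by apply/rowP => i; rewrite !mxE; case: ifP; rewrite ?addr0 ?add0r.
rewrite symmetryD symmetry_id; last first.
  rewrite (row_sum_delta y); apply: summx_sub => i _; rewrite mxE.
  case: ifP => [/orP[]/eqP->|]; last by rewrite scale0r sub0mx.
    by apply: scalemx_sub; exact: addsmxSl.
  by apply: scalemx_sub; exact: addsmxSr.
rewrite symmetry_opp; last first.
  apply: trmx_inj; rewrite trmx_mul trmxK trmx0.
  have zd i : (i == j) || (i == k) -> basis_vector R i *m z^T = 0.
    by move=> ijk; apply/matrixP => a b; rewrite -rowE !mxE ijk.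
  apply/sub_kermxP; rewrite addsmx_sub; apply/andP.
  by split; apply/sub_kermxP; apply: zd; rewrite eqxx ?orbT.
apply/rowP => i; rewrite !mxE.
by case: ifP; rewrite ?subr0 ?oppr0 ?addr0 ?add0r.
Qed.

Lemma preserved_by_range (T : Type) n (f : T -> 'rV[R]_n)
    (s : 'rV[R]_n -> 'rV[R]_n) (sigma : T -> T) :
  involutive sigma -> (forall p, s (f p) = f (sigma p)) ->
  preserved_by s (range f).
Proof.
move=> sK sE; apply/seteqP; split=> [_ [_ [p _ <-] <-]|_ [p _ <-]].
  by exists (sigma p).
exists (f (sigma p)); first by exists (sigma p).
by rewrite sE sK.
Qed.

End Symmetries.

(** * Curvature of a conformal metric *)

Lemma big_ord2 (V : nmodType) (F : 'I_2 -> V) : \sum_(i < 2) F i = F 0 + F 1.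
Proof.
by rewrite !big_ord_recl big_ord0 addr0; congr (_ + F _); apply/val_inj.
Qed.

Section ConformalMetrics.
Variable R : realType.
Variables (lam : R * R -> R) (g : R * R -> 'M[R]_2).
Hypothesis gE : forall p, g p = (lam p)%:M.
Hypothesis lam_gt0 : forall p, 0 < lam p.
Hypothesis lam_diff : forall p, differentiable lam p.

(** The partial derivatives of log lam. *)
Definition dlog (i : 'I_2) (p : R * R) : R := partial i lam p / lam p.

Lemma conformal_christoffel k i j p : christoffel g k i j p =
  2^-1 * ((k == j)%:R * dlog i p + (k == i)%:R * dlog j p
          - (i == j)%:R * dlog k p).
Proof.
have dg (a b c : 'I_2) :
    partial a (fun q => g q b c) p = (b == c)%:R * partial a lam p.
  have -> : (fun q => g q b c) = (fun q => (b == c)%:R * lam q).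
    by apply/funext => q; rewrite gE mxE mulr_natl.
  exact/deriveMl/diff_derivable.
rewrite /christoffel; congr (_ * _).
have lam0 : lam p != 0 by rewrite gt_eqF.
have gV l : invmx (g p) k l = (k == l)%:R / lam p.
  by rewrite gE invmx_scalar mxE mulr_natl.
rewrite (bigD1 k) //= big1 => [|l lk]; last first.
  by rewrite gV eq_sym (negbTE lk) mul0r mul0r.
rewrite gV !dg eqxx /dlog (eq_sym j k) (eq_sym i k).
by rewrite /=; field.
Qed.

Hypothesis dlog_diff : forall i p, differentiable (dlog i) p.

(** The quadratic terms in the Christoffel symbols cancel, which leaves the
    formula K dA = - (1/2) Laplacian (log lam) du dv. *)
Lemma conformal_curvature_density p :
  gauss_curvature g p * area_density g p =
  - (2^-1 * (partial 0 (dlog 0) p + partial 1 (dlog 1) p)).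
Proof.
have lam0 : lam p != 0 by rewrite gt_eqF.
rewrite /gauss_curvature /area_density gE det_scalar sqrtr_sqr gtr0_norm //.
(* g is diagonal, so only the component l = 0 of the Riemann tensor counts. *)
rewrite big_ord2 !mxE /= mulr0n mulr0 addr0 mulr1n.
have G011 : christoffel g 0 1 1 = (fun q => (- 2^-1) * dlog 0 q).
  by apply/funext => q; rewrite conformal_christoffel /=; ring.
have G001 : christoffel g 0 0 1 = (fun q => 2^-1 * dlog 1 q).
  by apply/funext => q; rewrite conformal_christoffel /=; ring.
have dZ c i j : partial i (fun q => c * dlog j q) p = c * partial i (dlog j) p.
  exact/deriveMl/diff_derivable/dlog_diff.
rewrite /riemann G011 G001 !dZ big_ord2 !conformal_christoffel /=.
move: (partial 0 _ p) (partial 1 _ p) (dlog 0 p) (dlog 1 p) (lam p) lam0.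
by move=> a b c d l l0; field.
Qed.

End ConformalMetrics.

(** * Proper maps *)

(** Near y, the image of C is the image of the compact set K `&` C, where K
    contains all the points that are mapped to the unit ball around y. *)
Lemma proper_closed_map (R : realType) (V W : normedModType R) (f : V -> W)
    (C : set V) :
  continuous f ->
  (forall M, exists2 K : set V, compact K & forall p, `|f p| <= M -> K p) ->
  closed C -> closed (f @` C).
Proof.
move=> cf pf cC y yC.
have [K cK Kf] := pf (`|y| + 1).
have cfCK : compact (f @` (K `&` C)).
  apply: continuous_compact; last exact: compact_closedI.
  exact: continuous_subspaceT.
suff : closure (f @` (K `&` C)) y.
  move/(compact_closed (@norm_hausdorff _ _) cfCK) => [p [_ Cp] <-].
  by exists p.
move=> N Ny.
have [_ [[p Cp <-] [Np yp]]] := yC _ (filterI Ny (nbhsx_ballx y 1 ltr01)).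
exists (f p); split => //; exists p => //; split => //; apply: Kf.
rewrite -ball_normE /= in yp.
rewrite -[f p](subrK y) addrC (le_trans (ler_normD _ _)) // lerD2l.
by rewrite distrC ltW.
Qed.

Lemma ler_coord (R : realType) n (x : 'rV[R]_n) k : `|x 0 k| <= `|x|.
Proof.
rewrite [leRHS]/Num.Def.normr /= mx_normrE.
exact: (le_bigmax _ (fun i => `|x i.1 i.2|) (0, k)).
Qed.

(** * The surface *)

Declare Scope ratexp_scope.
Delimit Scope ratexp_scope with X.
Bind Scope ratexp_scope with ratexp.
Notation "a + b" := (Add a b) : ratexp_scope.
Notation "a * b" := (Mul a b) : ratexp_scope.
Notation "c %:X" := (Cst c) (at level 2, format "c %:X") : ratexp_scope.
Notation "a ^+ n" := (iter n (Mul a) (Cst 1)) : ratexp_scope.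

Section Surface.
Variable R : realType.
Local Notation U := (VarU R).
Local Notation V := (VarV R).

Lemma surfaceE (u v : R) : surface (u, v) =
  vec4 (u ^+ 5 / 5 - 2 * u ^+ 3 * v ^+ 2 + u * v ^+ 4)
       (v ^+ 5 / 5 + u ^+ 4 * v - 2 * u ^+ 2 * v ^+ 3 - 2 * v)
       (2 * u)
       (2 * v ^+ 3 / 3 - 2 * u ^+ 2 * v).
Proof.
(* Once the scalars are visibly real, complex arithmetic reduces by computation
   to arithmetic on the real and imaginary parts. *)
have natV n : (n%:R^-1 : R[i]) = (n%:R^-1 : R)%:C%C.
  by rewrite fmorphV rmorph_nat.
rewrite /surface /R4_of_C2 /surfaceC !natV /=.
by congr vec4; rewrite ?exprS ?expr0 /=; field.
Qed.

Definition surface_exp (k : 'I_4) : ratexp R :=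
  nth (Cst 0)
    [:: (5^-1%:X * U ^+ 5 + (-2)%:X * (U ^+ 3 * V ^+ 2) + U * V ^+ 4)%X;
        (5^-1%:X * V ^+ 5 + U ^+ 4 * V + (-2)%:X * (U ^+ 2 * V ^+ 3)
          + (-2)%:X * V)%X;
        (2%:X * U)%X;
        ((2 / 3)%:X * V ^+ 3 + (-2)%:X * (U ^+ 2 * V))%X] k.

Lemma surface_polefree k : polefree (surface_exp k).
Proof. by case: k => [[|[|[|[|//]]]] ?] /=; intuition. Qed.

Lemma surface_rateval : @surface R = rateval_row surface_exp.
Proof.
apply/funext => -[u v]; rewrite surfaceE; apply/rowP => k; rewrite !mxE.
by case: k => [[|[|[|[|//]]]] ?] /=; field.
Qed.

(** 1 + |z^2 + c|^2 *)
Definition factor_exp (c : R) : ratexp R :=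
  (1%:X + (U ^+ 2 + (-1)%:X * V ^+ 2 + c%:X) ^+ 2 + 4%:X * (U ^+ 2 * V ^+ 2))%X.

(** The conformal factor of the surface. *)
Definition lambda_exp : ratexp R := (factor_exp (-1) * factor_exp 1)%X.

Lemma lambda_polefree : polefree lambda_exp.
Proof. by rewrite /=; intuition. Qed.

Lemma lambda_gt0 p : 0 < rateval lambda_exp p.
Proof.
have factor_gt0 c : 0 < rateval (factor_exp c) p.
  case: p => u v; have := sqr_ge0 (u * v); have := sqr_ge0 (u ^+ 2 - v ^+ 2 + c).
  by rewrite /=; nra.
exact: (mulr_gt0 (factor_gt0 _) (factor_gt0 _)).
Qed.

Lemma surface_smooth : smooth (@surface R).
Proof. by rewrite surface_rateval; apply/rateval_row_smooth/surface_polefree. Qed.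

Lemma surface_differentiable p : differentiable (@surface R) p.
Proof.
by rewrite surface_rateval; apply/rateval_row_differentiable/surface_polefree.
Qed.

Lemma surface_diff p v :
  'd (@surface R) p v = rateval_row (fun k => ratderiv v (surface_exp k)) p.
Proof.
rewrite -deriveE; last exact: surface_differentiable.
by rewrite -rateval_row_derive ?surface_rateval //; exact: surface_polefree.
Qed.

(** Conformality and the formula for lambda at once: both sides are polynomials
    in the coordinates of p, v and w. *)
Lemma surface_isometric p v w :
  inner ('d (@surface R) p v) ('d (@surface R) p w) =
  rateval lambda_exp p * inner_plane v w.
Proof.
rewrite !surface_diff /inner /inner_plane !big_ord_recl big_ord0 !mxE /=.
by field.
Qed.

Lemma surface_minimal : minimal (@surface R).
Proof.
split; split; [exact: surface_smooth| |exact: surface_smooth|] => p.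
  exists (rateval lambda_exp p) => [|v w]; first exact: lambda_gt0.
  exact: surface_isometric.
have pd i k : polefree (ratderiv (dir R i) (surface_exp k)).
  exact/polefree_deriv/surface_polefree.
have pS := surface_polefree.
rewrite big_ord2 surface_rateval !rateval_row_partial //.
apply/rowP => k; rewrite !mxE.
by case: k => [[|[|[|[|//]]]] ?] /=; field.
Qed.

Lemma surface_immersion : is_immersion (@surface R).
Proof.
split=> [|p v w vw]; first exact: surface_smooth.
have : inner ('d (@surface R) p (v - w)) ('d (@surface R) p (v - w)) = 0.
  rewrite linearB /= vw subrr /inner big1 // => k _.
  by rewrite mxE mul0r.
rewrite surface_isometric => /eqP; rewrite mulf_eq0 gt_eqF ?lambda_gt0 //=.
rewrite /inner_plane -!expr2 paddr_eq0 ?sqr_ge0 // !sqrf_eq0 /= !subr_eq0.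
by case: v w {vw} => v1 v2 [w1 w2] /= /andP[/eqP-> /eqP->].
Qed.

(** Suppose that (u, v) and (u, v') have the same image and v != v'.  The fourth
    coordinate gives v^2 + v v' + v'^2 = 3 u^2, which settles u = 0.  If u != 0,
    the first coordinate gives (v^2 - u^2)^2 = (v'^2 - u^2)^2, hence v' = - v or
    v^2 + v'^2 = 2 u^2.  In the former case v^2 = 3 u^2, and the second
    coordinate, odd in v, must vanish, which reads 16 u^4 / 5 + 2 = 0; in the
    latter v v' = u^2, so (v - v')^2 = 0. *)
Lemma surface_injective : injective (@surface R).
Proof.
move=> [u v] [u' v']; rewrite !surfaceE => /rowP eF.
have := eF 0; have := eF 1; have := eF 2; have := eF 3.
rewrite !mxE /= => e4 e3 e2 e1.
have {eF e3} uu : u = u' by lra.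
subst u'.
suff -> : v = v' by [].
apply/eqP; apply: contraT => vv'.
have nz : v - v' != 0 by rewrite subr_eq0.
have {}e4 : v ^+ 2 + v * v' + v' ^+ 2 = 3 * u ^+ 2.
  apply: (mulfI nz); lra.
have [u0|u0] := eqVneq u 0.
  subst u; move: nz; have : v ^+ 2 + v' ^+ 2 + (v + v') ^+ 2 = 0 by lra.
  move=> h; have v2 : v ^+ 2 = 0.
    by move: (sqr_ge0 v) (sqr_ge0 v') (sqr_ge0 (v + v')); lra.
  have v'2 : v' ^+ 2 = 0.
    by move: (sqr_ge0 v) (sqr_ge0 v') (sqr_ge0 (v + v')); lra.
  move/eqP: v2; move/eqP: v'2; rewrite !sqrf_eq0 => /eqP-> /eqP->.
  by rewrite subrr eqxx.
have {}e1 : (v - v') * ((v + v') * (v ^+ 2 + v' ^+ 2 - 2 * u ^+ 2)) = 0.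
  by apply: (mulfI u0); lra.
move: e1 => /eqP; rewrite mulf_eq0 (negbTE nz) /= mulf_eq0 => /orP[]/eqP h.
  have v'E : v' = - v by lra.
  subst v'.
  have v2 : v ^+ 2 = 3 * u ^+ 2 by lra.
  have v0 : v != 0 by apply: contraNneq nz => ->; rewrite oppr0 subr0.
  have h2 : v ^+ 4 / 5 + u ^+ 4 - 2 * u ^+ 2 * v ^+ 2 - 2 = 0.
    by apply: (mulfI v0); lra.
  have v4 : v ^+ 4 = 9 * u ^+ 4.
    have -> : v ^+ 4 = (v ^+ 2) ^+ 2 by ring.
    by rewrite v2; ring.
  have := sqr_ge0 (u ^+ 2); rewrite v2 v4 in h2; nra.
have : (v - v') ^+ 2 = 0 by lra.
by move/eqP; rewrite sqrf_eq0 (negbTE nz).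
Qed.

(** If the image has norm at most L >= 1, the third coordinate bounds |u| by L,
    and then the fourth, (2/3) v^3 - 2 u^2 v, exceeds L as soon as |v| > 3 L. *)
Lemma surface_proper M : exists2 K : set (R * R), compact K &
  forall p, `|surface p| <= M -> K p.
Proof.
pose L := Num.max M 1; have L1 : 1 <= L by rewrite le_max lexx orbT.
exists (`[- (3 * L), 3 * L] `*` `[- (3 * L), 3 * L]).
  by apply: compact_setX; exact: segment_compact.
move=> [u v] FM.
have {}FM k : `|surface (u, v) 0 k| <= L.
  by rewrite (le_trans (ler_coord _ _)) // (le_trans FM) // le_max lexx.
have := FM 2; have := FM 3; rewrite surfaceE !mxE /= !ler_norml.
move=> /andP[l1 l2] /andP[l3 l4].
split; rewrite /= in_itv /=; first by apply/andP; split; lra.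
have u2 : u ^+ 2 <= L ^+ 2 by nra.
rewrite -ler_norml leNgt; apply/negP => vL.
have v2 : (3 * L) ^+ 2 < v ^+ 2.
  by rewrite -(real_normK (num_real v)); nra.
have : `|v| * (2 / 3 * v ^+ 2 - 2 * u ^+ 2) <= L.
  rewrite -[X in _ * X <= _]ger0_norm; last by nra.
  rewrite -normrM ler_norml; apply/andP; split; lra.
nra.
Qed.

Lemma surface_embedding : is_embedding (@surface R).
Proof.
split; [exact: surface_immersion|exact: surface_injective|move=> O oO].
have := proper_closed_map (surface_smooth 0) surface_proper (open_closedC oO).
exists (~` (@surface R @` (~` O))); first exact: closed_openC.
apply/seteqP; split=> [_ [p Op <-]|_ [[p _ <-] nO]] /=.
  split; first by exists p.
  by move=> [q nq /surface_injective qp]; apply: nq; rewrite qp.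
by exists p => //; apply: contrapT => nOp; apply: nO; exists p.
Qed.

Lemma surface_symmetry02 :
  preserved_by (symmetry (plane R 0 2)) (range (@surface R)).
Proof.
apply: (preserved_by_range (sigma := fun p => (p.1, - p.2))).
  by case=> u v /=; rewrite opprK.
move=> [u v]; rewrite symmetry_plane !surfaceE; apply/rowP => k; rewrite !mxE.
by case: k => [[|[|[|[|//]]]] ?] /=; field.
Qed.

Lemma surface_symmetry13 :
  preserved_by (symmetry (plane R 1 3)) (range (@surface R)).
Proof.
apply: (preserved_by_range (sigma := fun p => (- p.1, p.2))).
  by case=> u v /=; rewrite opprK.
move=> [u v]; rewrite symmetry_plane !surfaceE; apply/rowP => k; rewrite !mxE.
by case: k => [[|[|[|[|//]]]] ?] /=; field.
Qed.

End Surface.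

(** * The divergence theorem on squares *)

Section Squares.
Variable R : realType.
Let mR : measurableType _ := measurableTypeR R.
Notation mu := (@lebesgue_measure R).
Notation mu2 := (mu \x mu)%E.

Lemma FTC_segment (f F : R -> R) (a : R) : 0 < a -> continuous f ->
  (forall x : R, is_derive x 1 F (f x)) ->
  (\int[mu]_(x in `[(- a)%R, a]) (f x)%:E = (F a - F (- a)%R)%:E)%E.
Proof.
move=> a0 cf dF.
have cF : continuous F.
  by move=> v; apply/differentiable_continuous/derivable1_diffP.
rewrite (@continuous_FTC2 _ _ F) //.
- by rewrite ltrNl; lra.
- exact: continuous_subspaceT.
- split=> [v _||]; first exact: ex_derive.
    by apply: cvg_at_right_filter; exact: cF.
  by apply: cvg_at_left_filter; exact: cF.
- by move=> v _; rewrite derive1E; exact: derive_val.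
Qed.

Definition square (a : R) : set (mR * mR) := `[- a, a] `*` `[- a, a].

Lemma measurable_square a : measurable (square a).
Proof. by apply: measurableX; exact: measurable_itv. Qed.

Lemma square_integrable e a : polefree e ->
  mu2.-integrable (square a) (EFin \o rateval e).
Proof.
move=> pe; apply: measurable_bounded_integrable.
- exact: measurable_square.
- apply: (@le_lt_trans _ _ (mu `[(- a)%R, a] * mu `[(- a)%R, a])%E).
    rewrite le_eqVlt; apply/orP; left; apply/eqP.
    by apply: product_measure1E; exact: measurable_itv.
  rewrite lebesgue_measure_itv /=.
  by case: ifP => _; rewrite ?mul0e ?ltry // -EFinB -EFinM ltry.
- by apply: measurable_funTS; exact: rateval_measurable.
- have cB : compact (`[- a, a] `*` `[- a, a] : set (R * R)).
    by apply: compact_setX; exact: segment_compact.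
  have cf : {within `[- a, a] `*` `[- a, a], continuous (rateval e)}.
    by apply: continuous_subspaceT; exact: rateval_continuous.
  have /compact_bounded[M [_ mrt]] := continuous_compact cf cB.
  by exists M; split; rewrite ?num_real // => ? ? ? ?; exact: mrt.
Qed.

Lemma slice_derive0 e (u v : R) : polefree e ->
  is_derive u 1 (fun x => rateval e (x, v))
    (rateval (ratderiv (dir R 0) e) (u, v)).
Proof.
move=> pe.
have [d dE] : is_derive (u, v) (dir R 0) (rateval e)
    (rateval (ratderiv (dir R 0) e) (u, v)).
  split; last exact: rateval_derive.
  exact/diff_derivable/rateval_differentiable.
have E : (fun h : R => h^-1 *: (rateval e (h *: 1 + u, v) - rateval e (u, v))) =
    (fun h => h^-1 *: (rateval e (h *: dir R 0 + (u, v)) - rateval e (u, v))).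
  apply/funext => h; congr (_ *: (rateval e _ - _)).
  by apply/pair_equal_spec; split; rewrite /= ?scaler0 ?add0r.
by split; rewrite /derivable /derive /= E.
Qed.

Lemma slice_derive1 e (u v : R) : polefree e ->
  is_derive v 1 (fun x => rateval e (u, x))
    (rateval (ratderiv (dir R 1) e) (u, v)).
Proof.
move=> pe.
have [d dE] : is_derive (u, v) (dir R 1) (rateval e)
    (rateval (ratderiv (dir R 1) e) (u, v)).
  split; last exact: rateval_derive.
  exact/diff_derivable/rateval_differentiable.
have E : (fun h : R => h^-1 *: (rateval e (u, h *: 1 + v) - rateval e (u, v))) =
    (fun h => h^-1 *: (rateval e (h *: dir R 1 + (u, v)) - rateval e (u, v))).
  apply/funext => h; congr (_ *: (rateval e _ - _)).
  by apply/pair_equal_spec; split; rewrite /= ?scaler0 ?add0r.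
by split; rewrite /derivable /derive /= E.
Qed.

Lemma slice0_continuous e (v : R) : polefree e ->
  continuous (fun x => rateval e (x, v)).
Proof.
move=> pe x; apply/differentiable_continuous/derivable1_diffP.
by have [] := slice_derive0 x v pe.
Qed.

Lemma slice1_continuous e (u : R) : polefree e ->
  continuous (fun x => rateval e (u, x)).
Proof.
move=> pe x; apply/differentiable_continuous/derivable1_diffP.
by have [] := slice_derive1 u x pe.
Qed.

Lemma slice1_integrable e (a u : R) : polefree e ->
  mu.-integrable `[- a, a] (EFin \o fun v => rateval e (u, v)).
Proof.
move=> pe; apply: continuous_compact_integrable; first exact: segment_compact.
by apply: continuous_subspaceT; exact: slice1_continuous.
Qed.

(** Fubini, then the fundamental theorem of calculus in the first variable.
    This lemma and the next one together are the divergence theorem for a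
    rational vector field. *)
Lemma square_integral_partial0 e (a : R) : 0 < a -> polefree e ->
  (\int[mu2]_(p in square a) (rateval (ratderiv (dir R 0) e) p)%:E =
   \int[mu]_(v in `[(- a)%R, a])
     (rateval e (a, v) - rateval e ((- a)%R, v))%:E)%E.
Proof.
move=> a0 pe; have pd := polefree_deriv (dir R 0) pe.
rewrite integral_mkcond -integral21_prod_meas1; last first.
  by apply/(integrable_mkcond _ (measurable_square a)); exact: square_integrable.
rewrite [RHS]integral_mkcond; apply: eq_integral => v _.
rewrite /fubini_G !patchE; case: ifPn => vI; last first.
  apply: integral0_eq => u _; rewrite patchE ifN //.
  by apply: contra vI => /set_mem[_ /mem_set].
rewrite -(FTC_segment a0 (slice0_continuous (v := v) pd)
  (fun u => slice_derive0 u v pe)).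
rewrite [RHS]integral_mkcond; apply: eq_integral => u _.
rewrite !patchE; congr (if _ then _ else _).
apply/idP/idP => [/set_mem[/mem_set]//|/set_mem uI].
by apply/mem_set; split => //; exact: set_mem.
Qed.

Lemma square_integral_partial1 e (a : R) : 0 < a -> polefree e ->
  (\int[mu2]_(p in square a) (rateval (ratderiv (dir R 1) e) p)%:E =
   \int[mu]_(u in `[(- a)%R, a])
     (rateval e (u, a) - rateval e (u, (- a)%R))%:E)%E.
Proof.
move=> a0 pe; have pd := polefree_deriv (dir R 1) pe.
rewrite integral_mkcond -integral12_prod_meas1; last first.
  by apply/(integrable_mkcond _ (measurable_square a)); exact: square_integrable.
rewrite [RHS]integral_mkcond; apply: eq_integral => u _.
rewrite /fubini_F !patchE; case: ifPn => uI; last first.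
  apply: integral0_eq => v _; rewrite patchE ifN //.
  by apply: contra uI => /set_mem[/mem_set].
rewrite -(FTC_segment a0 (slice1_continuous (u := u) pd)
  (fun v => slice_derive1 u v pe)).
rewrite [RHS]integral_mkcond; apply: eq_integral => v _.
rewrite !patchE; congr (if _ then _ else _).
apply/idP/idP => [/set_mem[_ /mem_set]//|/set_mem vI].
by apply/mem_set; split => //; exact: set_mem.
Qed.

Lemma bigcup_square : \bigcup_n square (n.+1%:R : R) = setT.
Proof.
apply/seteqP; split=> // -[u v] _.
have [n nE] : exists n : nat, `|u| + `|v| < n%:R.
  by exists (Num.bound (`|u| + `|v|)); apply: archi_boundP; rewrite addr_ge0.
exists n => //; split; rewrite /= in_itv /= -ler_norml.
  by rewrite -natr1; move: (normr_ge0 v); lra.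
by rewrite -natr1; move: (normr_ge0 u); lra.
Qed.

(** The constant c will be an error bound for the gradient of log lambda around
    its leading term 8 a / (a^2 + v^2), the first component of the gradient of
    8 log r on the side u = a. *)
Lemma side_continuous (a c : R) : 0 < a ->
  continuous (fun v : R => 8 * a / (a ^+ 2 + v ^+ 2) + c).
Proof.
move=> a0 v; apply: cvgD; last exact: cvg_cst.
apply: cvgM; first exact: cvg_cst.
apply: cvgV; first by rewrite gt_eqF // ltr_pwDl ?exprn_gt0 ?sqr_ge0.
by apply: cvgD; [exact: cvg_cst | exact: exprn_continuous].
Qed.

Lemma integral_side (a c : R) : 0 < a ->
  (\int[mu]_(v in `[(- a)%R, a]) (8 * a / (a ^+ 2 + v ^+ 2) + c)%R%:E =
   (4 * pi + 2 * a * c)%R%:E)%E.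
Proof.
move=> a0.
pose F (v : R) := 8 * atan (a^-1 * v) + c * v.
have dF (v : R) : is_derive v 1 F (8 * a / (a ^+ 2 + v ^+ 2) + c).
  have dm : is_derive v 1 (fun v : R => a^-1 * v) a^-1.
    by apply: is_derive_eq; rewrite scaler1.
  have dat : is_derive v 1 (fun v => atan (a^-1 * v))
      ((1 + (a^-1 * v) ^+ 2)^-1 * a^-1).
    exact: is_derive1_comp.
  apply: is_derive_eq; rewrite /GRing.scale /=.
  have n1 : a ^+ 2 + v ^+ 2 != 0.
    by rewrite gt_eqF // ltr_pwDl ?exprn_gt0 ?sqr_ge0.
  have n2 : 1 + (a^-1 * v) ^+ 2 != 0.
    by rewrite gt_eqF // ltr_pwDl ?sqr_ge0.
  by field; rewrite n1 gt_eqF.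
rewrite (FTC_segment a0 (side_continuous (c := c) a0) dF).
rewrite /F mulrN (mulVf (lt0r_neq0 a0)) atanN atan1; congr EFin.
by field.
Qed.

End Squares.

(** * The total curvature *)

Section TotalCurvature.
Variable R : realType.
Let mR : measurableType _ := measurableTypeR R.
Notation mu := (@lebesgue_measure R).
Notation mu2 := (mu \x mu)%E.
Local Notation lambda := (rateval (lambda_exp R)).

Definition dlog_exp (i : 'I_2) : ratexp R :=
  Mul (ratderiv (dir R i) (lambda_exp R)) (Inv (lambda_exp R)).

Lemma dlog_polefree i : polefree (dlog_exp i).
Proof.
split; first exact/polefree_deriv/lambda_polefree.
by split=> [|p]; [exact: lambda_polefree | rewrite gt_eqF ?lambda_gt0].
Qed.

Lemma dlog_rateval i : dlog lambda i = rateval (dlog_exp i).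
Proof.
by apply/funext => p; rewrite /dlog rateval_partial //; exact: lambda_polefree.
Qed.

(** The Laplacian of log lambda. *)
Definition laplacian_exp : ratexp R :=
  Add (ratderiv (dir R 0) (dlog_exp 0)) (ratderiv (dir R 1) (dlog_exp 1)).

Lemma laplacian_polefree : polefree laplacian_exp.
Proof. by split; exact/polefree_deriv/dlog_polefree. Qed.

Lemma surface_metric p : induced_metric (@surface R) p = (lambda p)%:M.
Proof.
have dE i : partial i (@surface R) p = 'd (@surface R) p (dir R i).
  by rewrite /partial deriveE //; exact: surface_differentiable.
apply/matrixP => i j; rewrite !mxE !dE surface_isometric /inner_plane.
case: i => [[|[|//]] ?]; case: j => [[|[|//]] ?] /=.
all: by rewrite ?mulr1n ?mulr0n; ring.
Qed.

(** The opposite sign makes it nonnegative, as the monotone convergence theorem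
    requires. *)
Definition neg_curvature (p : R * R) : R := 2^-1 * rateval laplacian_exp p.

Lemma curvature_densityE p :
  curvature_density (@surface R) p = (- neg_curvature p)%:E.
Proof.
rewrite /curvature_density (conformal_curvature_density surface_metric).
- by rewrite !dlog_rateval !rateval_partial //; exact: dlog_polefree.
- exact: lambda_gt0.
- exact/rateval_differentiable/lambda_polefree.
- by move=> i q; rewrite dlog_rateval; exact/rateval_differentiable/dlog_polefree.
Qed.

(** lambda is the product of the factors 1 + |f|^2 with f = z^2 - 1 and
    f = z^2 + 1, and the Laplacian of log (1 + |f|^2) is
    4 |f'|^2 / (1 + |f|^2)^2, with |f'|^2 = 4 r^2 for both. *)
Lemma neg_curvature_ge0 p : 0 <= neg_curvature p.
Proof.
have quot w (a b : ratexp R) : rateval b p != 0 ->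
    rateval (ratderiv w (Mul a (Inv b))) p =
    (rateval (ratderiv w a) p * rateval b p
     - rateval a p * rateval (ratderiv w b) p) / rateval b p ^+ 2.
  by move=> b0 /=; field.
have l0 := lambda_gt0 p.
apply: mulr_ge0 => //.
have -> : rateval laplacian_exp p =
    rateval (ratderiv (dir R 0) (dlog_exp 0)) p +
    rateval (ratderiv (dir R 1) (dlog_exp 1)) p by [].
rewrite !quot ?gt_eqF // -mulrDl.
apply: mulr_ge0; last by rewrite invr_ge0 exprn_ge0 // ltW.
set N := (X in 0 <= X).
have -> : N = 16 * (p.1 ^+ 2 + p.2 ^+ 2) *
    (rateval (factor_exp (-1)) p ^+ 2 + rateval (factor_exp 1) p ^+ 2).
  by rewrite /N /=; ring.
by rewrite !mulr_ge0 ?addr_ge0 ?sqr_ge0.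
Qed.

Lemma lambdaE (u v : R) (s := u ^+ 2 + v ^+ 2) (d := u ^+ 2 - v ^+ 2) :
  lambda (u, v) = (s ^+ 2 + 2) ^+ 2 - 4 * d ^+ 2.
Proof. by rewrite /s /d /=; ring. Qed.

Lemma dlog0E (u v : R) (s := u ^+ 2 + v ^+ 2) (d := u ^+ 2 - v ^+ 2) :
  rateval (dlog_exp 0) (u, v) =
  8 * u * (s * (s ^+ 2 + 2) - 2 * d) / lambda (u, v).
Proof. by rewrite [LHS]/=; congr (_ / _); rewrite /s /d; ring. Qed.

Lemma dlog_swap u v : rateval (dlog_exp 1) (u, v) = rateval (dlog_exp 0) (v, u).
Proof.
rewrite dlog0E lambdaE [LHS]/=; congr (_ / _); first by ring.
by ring.
Qed.

Lemma dlog_odd u v :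
  rateval (dlog_exp 0) (- u, v) = - rateval (dlog_exp 0) (u, v).
Proof. by rewrite !dlog0E !lambdaE !sqrrN !mulrN !mulNr. Qed.

(** With s = a^2 + v^2 and d = a^2 - v^2, the difference is 8 a N / (s lambda)
    where |N| <= 8 s^2.  As |d| <= s, lambda >= s^4, and a^3 <= s^2 because
    1 <= a and a^2 <= s, so the difference is at most 64 / a^2. *)
Lemma dlog_bound (a v : R) : 1 <= a ->
  `|rateval (dlog_exp 0) (a, v) - 8 * a / (a ^+ 2 + v ^+ 2)| <= 64 / a ^+ 2.
Proof.
move=> a1; set s := a ^+ 2 + v ^+ 2; set d := a ^+ 2 - v ^+ 2.
pose N := 4 * d ^+ 2 - 2 * s ^+ 2 - 2 * s * d - 4.
have v2 := sqr_ge0 v.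
have as2 : a ^+ 2 <= s by rewrite lerDl.
have s1 : 1 <= s by apply: le_trans as2; nra.
have l0 := lambda_gt0 (a, v).
have lE : lambda (a, v) = (s ^+ 2 + 2) ^+ 2 - 4 * d ^+ 2 := lambdaE a v.
have -> : rateval (dlog_exp 0) (a, v) - 8 * a / s =
    8 * a * N / (s * lambda (a, v)).
  rewrite dlog0E -/s -/d /N lE in l0 *.
  by field; apply/andP; split; rewrite gt_eqF //; lra.
have d2 : d ^+ 2 <= s ^+ 2 by rewrite /s /d; nra.
have ds : - s <= d <= s.
  by move: (sqr_ge0 a); rewrite /s /d => a2; apply/andP; split; lra.
have ls : s ^+ 4 <= lambda (a, v) by rewrite lE; nra.
have N8 : `|N| <= 8 * s ^+ 2.
  by case/andP: ds => ds1 ds2; rewrite ler_norml /N; apply/andP; split; nra.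
have a3 : a ^+ 3 <= s ^+ 2.
  have : a ^+ 3 <= (a ^+ 2) ^+ 2 by rewrite -exprM ler_weXn2l.
  by move/le_trans; apply; rewrite lerXn2r ?nnegrE ?sqr_ge0 //; lra.
have sl0 : 0 < s * lambda (a, v) by apply: mulr_gt0 => //; exact: lt_le_trans s1.
have a2 : 0 < a ^+ 2 by rewrite exprn_gt0 // (lt_le_trans ltr01).
rewrite normrM normfV (gtr0_norm sl0) ler_pdivrMr // [leRHS]mulrAC ler_pdivlMr //.
rewrite !normrM (ger0_norm (_ : 0 <= 8 :> R)) // (ger0_norm (_ : 0 <= a)); last by lra.
have h1 : a ^+ 3 * `|N| <= s ^+ 2 * (8 * s ^+ 2).
  by apply: ler_pM => //; apply: exprn_ge0; lra.
have h2 : s ^+ 4 <= s * lambda (a, v).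
  by apply: le_trans ls _; rewrite ler_peMl // ltW.
have -> : 8 * a * `|N| * a ^+ 2 = 8 * (a ^+ 3 * `|N|) by ring.
have e4 : s ^+ 2 * (8 * s ^+ 2) = 8 * s ^+ 4 by ring.
lra.
Qed.

(** The flux of the gradient of log lambda through the side u = a. *)
Definition flux (a : R) : \bar R :=
  (\int[mu]_(v in `[(- a)%R, a]) (rateval (dlog_exp 0) (a, v))%:E)%E.

Lemma flux_bounds a : 1 <= a ->
  ((4 * pi - 128 / a)%R%:E <= flux a <= (4 * pi + 128 / a)%R%:E)%E.
Proof.
move=> a1; have a0 : 0 < a by exact: lt_le_trans a1.
have int_side c : mu.-integrable `[- a, a]
    (EFin \o fun v => 8 * a / (a ^+ 2 + v ^+ 2) + c).
  apply: continuous_compact_integrable; first exact: segment_compact.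
  by apply: continuous_subspaceT; exact: side_continuous.
have int_dlog := slice1_integrable a a (dlog_polefree 0).
(* The error 64 / a^2 is integrated over a segment of length 2 a. *)
have cE c : 4 * pi + 2 * a * (c * (64 / a ^+ 2)) = 4 * pi + c * (128 / a).
  by field; rewrite gt_eqF.
have -> : 4 * pi - 128 / a = 4 * pi + -1 * (128 / a) by rewrite mulN1r.
have -> : 4 * pi + 128 / a = 4 * pi + 1 * (128 / a) by rewrite mul1r.
rewrite -!cE -!integral_side //.
apply/andP; split; apply: le_integral; try exact: int_side; try exact: int_dlog.
all: try exact: measurable_itv.
all: move=> v _; rewrite lee_fin; have := dlog_bound v a1; rewrite ler_distl.
all: by case/andP; lra.
Qed.

(** The symmetries of lambda turn the four boundary terms into four copies of
    [flux a]. *)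
Lemma square_total_curvature a : 0 < a ->
  (\int[mu2]_(p in square a) (neg_curvature p)%:E = 2%:E * flux a)%E.
Proof.
move=> a0; have pG := dlog_polefree.
have pD i : polefree (ratderiv (dir R i) (dlog_exp i)) by exact: polefree_deriv.
rewrite /neg_curvature; under eq_integral do rewrite EFinM.
rewrite integralZl; last 2 first.
- exact: measurable_square.
- exact: (square_integrable a laplacian_polefree).
have -> : (\int[mu2]_(p in square a) (rateval laplacian_exp p)%:E =
    \int[mu2]_(p in square a)
      ((rateval (ratderiv (dir R 0) (dlog_exp 0)) p)%:E +
       (rateval (ratderiv (dir R 1) (dlog_exp 1)) p)%:E))%E by [].
rewrite integralD; last 3 first.
- exact: measurable_square.
- exact: (square_integrable a (pD 0)).
- exact: (square_integrable a (pD 1)).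
rewrite square_integral_partial0 // square_integral_partial1 //.
have int_dlog := slice1_integrable a a (pG 0).
have -> : (\int[mu]_(u in `[(- a)%R, a]) (rateval (dlog_exp 1) (u, a) -
    rateval (dlog_exp 1) (u, (- a)%R))%:E = 2%:E * flux a)%E.
  rewrite -integralZl //; apply: eq_integral => u _.
  by rewrite !dlog_swap dlog_odd -EFinM; congr EFin; ring.
have -> : (\int[mu]_(v in `[(- a)%R, a]) (rateval (dlog_exp 0) (a, v) -
    rateval (dlog_exp 0) ((- a)%R, v))%:E = 2%:E * flux a)%E.
  rewrite -integralZl //; apply: eq_integral => v _.
  by rewrite dlog_odd -EFinM; congr EFin; ring.
have : flux a \is a fin_num by exact: integrable_fin_num.
by move=> /fineK <-; rewrite -!EFinM; congr EFin; rewrite /=; field.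
Qed.

Lemma neg_curvature_measurable :
  measurable_fun setT (fun p : mR * mR => (neg_curvature p)%:E).
Proof.
apply/measurable_EFinP.
apply: measurable_funM; first exact: measurable_cst.
exact: (rateval_measurable laplacian_polefree).
Qed.

Lemma integral_neg_curvature :
  (\int[mu2]_p (neg_curvature p)%:E = (8 * pi)%R%:E)%E.
Proof.
have mD := neg_curvature_measurable.
have cvg_squares :
    (\int[mu2]_(p in square n.+1%:R) (neg_curvature p)%:E @[n --> \oo] -->
     \int[mu2]_p (neg_curvature p)%:E)%E.
  rewrite -bigcup_square; apply: ge0_nondecreasing_set_cvg_integral.
  - apply/nondecreasing_seqP => n; rewrite subsetEset => -[u v] [].
    rewrite /square /= !in_itv /= => /andP[? ?] /andP[? ?].
    by rewrite -[n.+2%:R]natr1; split; apply/andP; split; lra.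
  - by move=> n; exact: measurable_square.
  - by move=> n; exact: measurable_funTS.
  - by move=> n p _; rewrite lee_fin neg_curvature_ge0.
have squareE :
    (fun n => \int[mu2]_(p in square n.+1%:R) (neg_curvature p)%:E)%E =
    (fun n => 2%:E * flux n.+1%:R)%E.
  by apply/funext => n; rewrite square_total_curvature.
rewrite squareE in cvg_squares.
apply: (cvg_unique (@ereal_hausdorff R) cvg_squares).
have lim_bound (s : R) :
    (8 * pi + s * (256 * n.+1%:R^-1))%:E @[n --> \oo] --> (8 * pi)%:E.
  apply: cvg_EFin; first by near=> n.
  rewrite -[X in _ --> X]addr0; apply: cvgD; first exact: cvg_cst.
  rewrite -(mulr0 s); apply: cvgM; first exact: cvg_cst.
  rewrite -(mulr0 256); apply: cvgM; first exact: cvg_cst.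
  exact: cvg_harmonic.
apply: (squeeze_cvge _ (lim_bound (-1)) (lim_bound 1)); near=> n.
have n1 : 1 <= n.+1%:R :> R by rewrite ler1n.
have /andP[lo hi] := flux_bounds n1.
apply/andP; split.
  have -> : (8 * pi + -1 * (256 * n.+1%:R^-1) : R)%:E =
      (2%:E * (4 * pi - 128 / n.+1%:R)%R%:E)%E.
    by rewrite -EFinM; congr EFin; ring.
  by apply: lee_wpmul2l.
have -> : (8 * pi + 1 * (256 * n.+1%:R^-1) : R)%:E =
    (2%:E * (4 * pi + 128 / n.+1%:R)%R%:E)%E.
  by rewrite -EFinM; congr EFin; ring.
by apply: lee_wpmul2l.
Unshelve. all: by end_near. Qed.

Lemma surface_total_curvature : has_total_curvature (@surface R) (- (8 * pi)).
Proof.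
rewrite /has_total_curvature.
have -> : @curvature_density R 4 (@surface R) =
    (fun p => - (neg_curvature p)%:E)%E.
  by apply/funext => p; rewrite curvature_densityE.
have intD : mu2.-integrable setT (fun p => (neg_curvature p)%:E).
  apply/integrableP; split; first exact: neg_curvature_measurable.
  under eq_integral do rewrite gee0_abs ?lee_fin ?neg_curvature_ge0 //.
  by rewrite integral_neg_curvature ltry.
split; first exact: (integrableN intD).
by rewrite integralN ?integral_neg_curvature //; exact: integrable_add_def.
Qed.

End TotalCurvature.

Theorem proposition6 (R : realType) :
  (forall u v : R, surface (u, v) =
     vec4 (u ^+ 5 / 5 - 2 * u ^+ 3 * v ^+ 2 + u * v ^+ 4)
          (v ^+ 5 / 5 + u ^+ 4 * v - 2 * u ^+ 2 * v ^+ 3 - 2 * v)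
          (2 * u)
          (2 * v ^+ 3 / 3 - 2 * u ^+ 2 * v)) /\
  minimal (@surface R) /\
  is_embedding (@surface R) /\
  has_total_curvature (@surface R) (- (8 * pi)) /\
  preserved_by (symmetry (plane R 0 2)) (range (@surface R)) /\
  preserved_by (symmetry (plane R 1 3)) (range (@surface R)).
Proof.
split; first exact: surfaceE.
split; first exact: surface_minimal.
split; first exact: surface_embedding.
split; first exact: surface_total_curvature.
by split; [exact: surface_symmetry02 | exact: surface_symmetry13].
Qed.
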